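(* Let $D=[0,1]^d$, $F=C(D)$, and let $\nu$ be an arbitrary (Borel) probability measure on $F$. Let $\mathrm{Int}:F\to\mathbb{R}$, $\mathrm{Int}(f)=\int_D f(x)\,dx$, and $\mathrm{App}:F\to L_2(D)$, $\mathrm{App}(f)=f$. If $$\mathrm{comp}^{\mathrm{avg}}(\varepsilon,\mathrm{Int},\nu)=\Omega\left(\varepsilon^{-p}\right)$$ for some $p$ (obviously, $p\le 2$ whenever $\|f\|_{L_2(D)}^2$ has a finite $\nu$-expectation), then $$\mathrm{comp}^{\mathrm{avg}}(\varepsilon,\mathrm{App},\nu)=\Omega\left(\varepsilon^{-p(1+p/(2-p))}\right).$$
   Context: Here $d\ge1$ is the number of variables. Problem and information: let $S:F\to G$ be either $S=\mathrm{Int}$ with $G=\mathbb{R}$, or $S=\mathrm{App}$ with $G=L_2(D)$. Information about $f$ is a finite vector of function values $N(f)=N_t(f)=[f(x_1),\dots,f(x_n)]$ at points $x_i\in D$. The points and their number $n=n(f)$ (the cardinality) may be chosen adaptively and/or randomly: $x_i$ may depend on the previously computed values $f(x_1),\dots,f(x_{i-1})$ and on the outcome of a random process $t$ (i.e. $x_i$ is drawn from an arbitrary distribution that may depend on the previously computed values), and $n(f)$ may likewise depend on the computed values and on $t$. An algorithm using $N$ is an arbitrary, possibly randomized, mapping $\phi=\phi_t:N(F)\to G$; it produces the approximation $\phi_t(N_t(f))$ to $S(f)$. For a probability measure $\nu$ on $F$, the average error and average cost are $$e^{\mathrm{avg}}(\phi,N,S,\nu)=\sqrt{\mathrm{E}_\nu\mathrm{E}_t\,\|S(f)-\phi_t(N_t(f))\|_G^2},\qquad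 \mathrm{cost}^{\mathrm{avg}}(\phi,N,S,\nu)=\mathrm{E}_\nu\mathrm{E}_t\,(n(f)),$$ where $\mathrm{E}_\nu$, $\mathrm{E}_t$ are expectations with respect to $\nu$ and $t$; the cost counts only function values. The average-case complexity is $$\mathrm{comp}^{\mathrm{avg}}(\varepsilon,S,\nu)=\inf\{\mathrm{cost}^{\mathrm{avg}}(\phi,N,S,\nu): e^{\mathrm{avg}}(\phi,N,S,\nu)\le\varepsilon\},$$ the infimum being over all randomized (and possibly adaptive) $N$ and $\phi$. The notation $a(\varepsilon)=\Omega(b(\varepsilon))$ is the usual asymptotic lower bound as $\varepsilon\to0^+$: there are constants $c>0$ and $\varepsilon_0>0$ with $a(\varepsilon)\ge c\,b(\varepsilon)$ for all $0<\varepsilon\le\varepsilon_0$. *)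

(* Defs.v *)
From HB Require Import structures.
From mathcomp Require Import all_boot all_order all_algebra.
From mathcomp Require Import all_classical all_reals all_analysis.
From mathcomp Require Import measurable_realfun.
From mathcomp Require Import lra.

Set Implicit Arguments.
Unset Strict Implicit.
Unset Printing Implicit Defensive.

Import Order.TTheory GRing.Theory Num.Theory.
Import numFieldNormedType.Exports.

Local Open Scope classical_set_scope.
Local Open Scope ring_scope.

Section cube.
Variables (R : realType) (d : nat).

Definition unit_cube : set 'rV[R]_d :=
  [set x | forall i, 0 <= x ord0 i <= 1].

Definition cube : Type := set_type unit_cube.

HB.instance Definition _ := Topological.copy cube (set_type unit_cube).

(* The nearest point of the cube, coordinatewise. *)
Definition clamp_row (x : 'rV[R]_d) : 'rV[R]_d :=
  \row_i Num.max 0 (Num.min 1 (x ord0 i)).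

Lemma clamp_row_cube x : clamp_row x \in unit_cube.
Proof.
rewrite inE => i; rewrite mxE le_max lexx/= ge_max ler01/=.
by rewrite ge_min lexx.
Qed.

Definition clamp (x : 'rV[R]_d) : cube := SigSub (clamp_row_cube x).

HB.instance Definition _ := isPointed.Build cube (clamp 0).

HB.instance Definition _ :=
  Measurable.copy cube (g_sigma_algebraType (@open cube)).

Lemma clamp_rowK (x : cube) : clamp (set_val x) = x.
Proof.
apply: val_inj => /=; apply/rowP => i; rewrite mxE.
have /(_ i) /andP[x0 x1] := set_valP x.
by rewrite min_r// max_r.
Qed.

Lemma set_val_continuous : continuous (set_val : cube -> 'rV[R]_d).
Proof. exact: initial_continuous. Qed.

Lemma clamp_dist (u v : R) :
  `|Num.max 0 (Num.min 1 u) - Num.max 0 (Num.min 1 v)| <= `|u - v|.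
Proof.
rewrite /Num.max /Num.min ler_norml.
case: (ltP 1 u) => ?; case: (ltP 1 v) => ?; rewrite ?ltr01//;
  do ?case: ifPn; rewrite -?leNgt => *;
  (case: (lerP 0 (u - v)) => ?; [rewrite ger0_norm//|rewrite ltr0_norm//]);
  apply/andP; split; lra.
Qed.

Lemma clamp_row_continuous : continuous clamp_row.
Proof.
move=> x A /nbhs_ballP[e /= e0 xA]; apply/nbhs_ballP; exists e => //= y xy.
apply: xA; move: xy => [_ xy]; split=> // i j; move: (xy i j).
rewrite !ord1 !mxE /ball/=; apply: le_lt_trans; exact: clamp_dist.
Qed.

Lemma clamp_continuous : continuous clamp.
Proof. apply: continuous_comp_initial; exact: clamp_row_continuous. Qed.

Lemma cube_compact : compact [set: cube].
Proof.
have -> : [set: cube] = clamp @` [set v : 'rV[R]_d | forall i, `[0, 1]%classic (v ord0 i)].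
  rewrite eqEsubset; split=> // x _; exists (set_val x); last exact: clamp_rowK.
  by move=> i /=; rewrite in_itv/=; exact: (set_valP x).
apply: continuous_compact; last exact: rV_compact (fun=> @segment_compact R 0 1).
by apply: continuous_subspaceT; exact: clamp_continuous.
Qed.

Definition cube_of_tuple (t : d.-tuple (measurableTypeR R)) : cube :=
  clamp (\row_i tnth t i).

Lemma measurable_cube_of_tuple : measurable_fun setT cube_of_tuple.
Proof.
apply: (measurability (@open cube)) => // _ [U [V oV <-] <-].
rewrite setTI.
pose B (q : 'rV[rat]_d * nat) (t : d.-tuple (measurableTypeR R)) :=
  forall i, ball (ratr (q.1 ord0 i) : R) q.2.+1%:R^-1
    (Num.max 0 (Num.min 1 (tnth t i))).
pose I := [set q : 'rV[rat]_d * nat |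
  forall t, B q t -> V (clamp_row (\row_i tnth t i))].
have -> : cube_of_tuple @^-1` (set_val @^-1` V) =
    \bigcup_(q in I) [set t | B q t].
  rewrite eqEsubset; split=> t /=; last by move=> [q Iq Bq]; exact: Iq.
  move=> Vt; have /nbhs_ballP[e /= e0 teV] := open_nbhs_nbhs (conj oV Vt).
  pose n := Num.truncn (2 / e).
  have ne : n.+1%:R^-1 < e / 2.
    by rewrite -[e / 2]invf_div ltf_pV2 ?posrE ?divr_gt0// truncnS_gt.
  pose c i := Num.max 0 (Num.min 1 (tnth t i)).
  have /choice[q qc] : forall i, exists q : rat, `|ratr q - c i| < n.+1%:R^-1.
    move=> i; have n0 : 0 < n.+1%:R^-1 :> R by rewrite invr_gt0.
    have [|q] := @rat_in_itvoo R (c i - n.+1%:R^-1) (c i + n.+1%:R^-1).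
      by move: n0; move: (_^-1) => r r0; lra.
    by rewrite in_itv/= -ltr_distlC distrC; exists q.
  exists (\row_i q i, n) => [u Bu|i]; last by rewrite /ball/= mxE; exact: qc.
  apply: teV; split=> // i j; rewrite !ord1 !mxE /ball/= distrC.
  have := Bu j; rewrite /ball/= mxE distrC => uq.
  apply: le_lt_trans (ler_distD (ratr (q j)) _ _) _.
  rewrite [e]splitr; apply: ltrD; last exact: lt_trans uq ne.
  by rewrite distrC; exact: lt_trans (qc j) ne.
rewrite bigcup_mkcond; apply: countable_bigcupT_measurable => // q.
case: ifPn => // _.
rewrite [X in measurable X](_ : _ = \bigcap_(i : 'I_d)
    [set t | ball (ratr (q.1 ord0 i) : R) q.2.+1%:R^-1
      (Num.max 0 (Num.min 1 (tnth t i)))]); last first.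
  by rewrite eqEsubset; split=> t /= Bt i => [_|]; exact: Bt.
apply: fin_bigcap_measurable => // i _.
rewrite -[X in measurable X]setTI.
have mc : measurable_fun setT (fun t : d.-tuple (measurableTypeR R) =>
    Num.max 0 (Num.min 1 (tnth t i))).
  apply: measurable_maxr; first exact: measurable_cst.
  apply: measurable_minr; first exact: measurable_cst.
  exact: measurable_tnth.
exact: (mc measurableT (ball _ _) (measurable_ball _ _)).
Qed.

HB.instance Definition _ :=
  isMeasurableFun.Build _ _ _ _ cube_of_tuple measurable_cube_of_tuple.

End cube.

Section uniform.
Variable R : realType.
Local Open Scope ereal_scope.

Definition cons_tuple n (z : measurableTypeR R * n.-tuple (measurableTypeR R)) :
  n.+1.-tuple (measurableTypeR R) := [the n.+1.-tuple _ of z.1 :: z.2].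

Lemma measurable_cons_tuple n : measurable_fun setT (@cons_tuple n).
Proof. exact: measurable_cons. Qed.

HB.instance Definition _ n :=
  isMeasurableFun.Build _ _ _ _ (@cons_tuple n) (@measurable_cons_tuple n).

Fixpoint uniform_tuple n : probability (n.-tuple (measurableTypeR R)) R :=
  match n with
  | 0 => \d_ [tuple]
  | n'.+1 => distribution (uniform_prob (@ltr01 R) \x uniform_tuple n')%E
                 (@cons_tuple n')
  end.

(* Lebesgue measure on the cube: the law of d independent uniform coordinates,
   carried over from tuples (the clamp only acts on a null set). *)
Definition cube_measure d : probability (cube R d) R :=
  distribution (uniform_tuple d) (@cube_of_tuple R d).

Lemma uniform_tuple_box n (A : 'I_n -> set (measurableTypeR R)) :
  (forall i, measurable (A i)) ->
  uniform_tuple n [set t | forall i, A i (tnth t i)] =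
  \prod_(i < n) uniform_prob (@ltr01 R) (A i).
Proof.
elim: n A => [|n IHn] A mA /=.
  rewrite big_ord0 diracE mem_set//= => -[] //.
rewrite /distribution /pushforward big_ord_recl.
rewrite (_ : _ @^-1` _ =
    A ord0 `*` [set t | forall i, A (lift ord0 i) (tnth t i)]); last first.
  rewrite eqEsubset; split=> -[x t] /=.
    move=> At; split=> [|i]; first exact: (At ord0).
    by have := At (lift ord0 i); rewrite tnthS.
  move=> [A0 At] i; case: (unliftP ord0 i) => [j|] ->; last exact: A0.
  by rewrite tnthS; exact: At.
rewrite product_measure1E//; first by congr (_ * _); exact: IHn.
rewrite [X in measurable X](_ : _ = \bigcap_(i : 'I_n)
    [set t : n.-tuple (measurableTypeR R) | A (lift ord0 i) (tnth t i)]).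
  apply: fin_bigcap_measurable => // i _.
  by rewrite -[X in measurable X]setTI; exact: measurable_tnth.
by rewrite eqEsubset; split=> t /= Bt i => [_|]; exact: Bt.
Qed.

Lemma cube_measure_box d (a b : 'rV[R]_d) :
  (forall i, 0 <= a ord0 i <= b ord0 i /\ b ord0 i <= 1)%R ->
  cube_measure d [set x : cube R d |
    forall i, a ord0 i <= (set_val x : 'rV[R]_d) ord0 i <= b ord0 i]%R
  = (\prod_(i < d) (b ord0 i - a ord0 i))%R%:E.
Proof.
move=> ab; rewrite /cube_measure/= /distribution /pushforward.
pose clamp1 (u : R) : R := Num.max 0%R (Num.min 1%R u).
have mclamp1 : measurable_fun [set: measurableTypeR R] clamp1.
  apply: measurable_maxr; first exact: measurable_cst.
  by apply: measurable_minr; first exact: measurable_cst.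
pose A i : set (measurableTypeR R) :=
  clamp1 @^-1` `[a ord0 i, b ord0 i]%classic.
rewrite (_ : _ @^-1` _ = [set t | forall i, A i (tnth t i)]); last first.
  by rewrite eqEsubset; split=> t /= + i => /(_ i); rewrite mxE mxE /A/= in_itv.
rewrite uniform_tuple_box => [|i]; last first.
  by rewrite -[A i]setTI; apply: mclamp1 => //; exact: measurable_itv.
rewrite -prodEFin; apply: eq_bigr => i _.
have [/andP[a0 lab] b1] := ab i.
rewrite /uniform_prob integral_uniform_pdf.
rewrite (_ : A i `&` _ = `[a ord0 i, b ord0 i]%classic); last first.
  rewrite eqEsubset; split=> x /=; rewrite /A/= !in_itv/= /clamp1.
    by move=> [+ /andP[x0 x1]]; rewrite min_r// max_r.
  move=> /andP[ax xb]; have x0 := le_trans a0 ax; have x1 := le_trans xb b1.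
  by rewrite x0 x1 min_r// max_r// ax xb.
rewrite (eq_integral (cst 1)) => [|x]; last first.
  rewrite inE/= in_itv/= => /andP[ax xb]; rewrite /uniform_pdf.
  by rewrite (le_trans a0 ax) (le_trans xb b1)/= subr0 invr1.
rewrite integral_cst//= lebesgue_measure_itv/= lte_fin mul1e -EFinB.
case: ltP => // ba; apply/esym/eqP.
by rewrite eqe subr_eq0 eq_le lab ba.
Qed.

End uniform.

Section CD.
Variables (R : realType) (d : nat).

Definition CD : Type := continuousType (cube R d) R.

(* sup-norm topology; measures on CD are Borel measures for it *)
HB.instance Definition _ := Topological.copy CD
  (initial_topology (id : CD -> {uniform cube R d -> R})).

HB.instance Definition _ :=
  isPointed.Build CD (mkcts (@cst_continuous (cube R d) R 0)).

HB.instance Definition _ := Measurable.copy CD (g_sigma_algebraType (@open CD)).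

Lemma CD_openP (U : set CD) : open U <->
  forall f, U f -> exists2 e : R, 0 < e &
    forall g : CD, (forall x, `|f x - g x| < e) -> U g.
Proof.
split=> [[V oV <-] f Vf|Ue].
  have : nbhs (f : {uniform cube R d -> R}) V by exact: open_nbhs_nbhs.
  move=> /uniform_nbhs[E [+ EV]]; rewrite -entourage_ballE => -[e /= e0 eE].
  by exists e => // g fg; apply: EV => x _; apply: eE => /=; exact: fg.
exists [set h : {uniform cube R d -> R} | exists f : CD, U f /\
    exists2 e : R, 0 < e & (forall g : CD,
      (forall x, `|f x - g x| < e) -> U g) /\
    exists2 r : R, 0 < r & forall x, `|f x - h x| < e - r].
  rewrite openE => h /= [f [Uf [e e0 [eU [r r0 fh]]]]].
  apply/uniform_nbhs; exists [set z : R * R | ball z.1 (r / 2) z.2]; split.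
    by rewrite -entourage_ballE; exists (r / 2) => //=; rewrite divr_gt0.
  move=> k /= hk; exists f; split=> //; exists e => //; split=> //.
  exists (r / 2) => [|x]; first by rewrite divr_gt0.
  have := hk x I; rewrite /ball/=; have := fh x.
  by have := ler_distD (h x) (f x) (k x); lra.
rewrite eqEsubset; split=> g /=.
  move=> [f [_ [e _ [eU [r r0 fg]]]]]; apply: eU => x.
  by have := fg x; lra.
move=> Ug; have [e e0 eU] := Ue _ Ug.
exists g; split=> //; exists e => //; split=> //; exists (e / 2) => [|x].
  by rewrite divr_gt0.
by rewrite subrr normr0; lra.
Qed.

Lemma CD_Lfun (f : CD) : (f : cube R d -> R) \in Lfun (cube_measure R d) 2%:E.
Proof.
have cf : continuous (f : cube R d -> R) by exact: cts_fun.
have mf : measurable_fun setT (f : cube R d -> R).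
  apply: (measurability _ (RGenOpens.measurableE R)) => _ [_ [a [b ->] <-]].
  rewrite setTI; apply: sub_sigma_algebra.
  by move/continuousP : cf; apply; exact: interval_open.
have /compact_bounded[M [_ fM]] : compact [set f x | x in [set: cube R d]].
  apply: continuous_compact; last exact: cube_compact.
  exact: continuous_subspaceT.
have {}fM x : `|f x| <= M + 1 by apply: fM; [rewrite ltrDl|exists x].
rewrite inE; apply/andP; split; rewrite inE//=.
rewrite /finite_norm unlock /Lnorm poweR_lty//.
have mf2 : measurable_fun setT (fun x => ((`|f x| `^ 2)%:E)%E).
  apply/measurable_EFinP.
  apply: (@measurableT_comp _ _ _ _ _ _ (@powR R ^~ 2)) => //.
  exact: measurableT_comp.
apply: (@le_lt_trans _ _ (\int[cube_measure R d]_x (((M + 1) `^ 2)%:E))%E).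
  apply: ge0_le_integral => // x _; first by rewrite lee_fin powR_ge0.
  rewrite lee_fin ge0_ler_powR// nnegrE// (le_trans _ (fM x))//.
by rewrite integral_cst// ltey_eq fin_numM// fin_num_measure.
Qed.

(* Elements of L2 are represented by square-integrable functions; norms do not
   see null sets. *)
Definition L2 : Type := LfunType (cube_measure R d) (lee1n 2).
HB.instance Definition _ := GRing.Zmodule.on L2.

Definition CD_L2 (f : CD) : L2 := Lfun_Sub _ (CD_Lfun f).

(* [measurable_map h] says that h is a random element of the codomain. *)
Record problem := Problem {
  codomain : zmodType;
  codomain_norm : codomain -> \bar R;
  measurable_map : forall e (T : measurableType e), (T -> codomain) -> Prop;
  solution : CD -> codomain }.

Definition integration : problem := {|
  codomain := R;
  codomain_norm := fun y => `|y|%:E;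
  measurable_map := fun e T h => measurable_fun [set: T] h;
  solution := fun f => \int[cube_measure R d]_x f x |}.

(* A map into the separable space of L2 classes is Borel iff it has jointly
   measurable representatives; the representatives are taken to be such. *)
Definition L2_approximation : problem := {|
  codomain := L2;
  codomain_norm := fun g : L2 => ('N[cube_measure R d]_2%:E[EFin \o g])%E;
  measurable_map := fun e T (h : T -> L2) =>
    measurable_fun [set: T * cube R d] (fun z => h z.1 z.2);
  solution := CD_L2 |}.

(* The values of f gathered in at most n rounds: [q y] is the next point to
   evaluate after having seen the values y, or None to stop. *)
Definition observe (q : seq R -> option (cube R d)) (f : CD) (n : nat) : seq R :=
  iter n (fun y => if q y is Some x then rcons y (f x) else y) [::].

(* The random process t is a point of the probability space [seed]; it may
   influence the points, the stopping time and the output. Points are not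
   arguments of [query] and [output], being determined by t and the values.
   No measurability is imposed on [query] and [output] separately, only on the
   quantities whose expectations are taken. *)
Record algorithm (S : problem) := Algorithm {
  seed_display : measure_display;
  seed : measurableType seed_display;
  seed_law : probability seed R;
  query : seed -> seq R -> option (cube R d);
  output : seed -> seq R -> codomain S;
  query_halts : forall f t, exists n, ~~ query t (observe (query t) f n);
  cardinality (f : CD) (t : seed) : nat := ex_minn (query_halts f t);
  information (f : CD) (t : seed) : seq R :=
    observe (query t) f (cardinality f t);
  measurable_cardinality :
    measurable_fun setT (fun z : CD * seed => cardinality z.1 z.2);
  measurable_output :
    measurable_map (fun z : CD * seed => output z.2 (information z.1 z.2)) }.

Section complexity.
Variables (S : problem) (nu : probability CD R).
Local Open Scope ereal_scope.

Definition avg_error (A : algorithm S) : \bar R :=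
  sqrte (\int[nu]_f \int[seed_law A]_t
    (codomain_norm (solution S f - output t (information f t))%R) ^+ 2).

Definition avg_cost (A : algorithm S) : \bar R :=
  \int[nu]_f \int[seed_law A]_t (cardinality f t)%:R%:E.

Definition avg_complexity (eps : R) : \bar R :=
  ereal_inf [set c | exists2 A : algorithm S,
    avg_error A <= eps%:E & c = avg_cost A].

End complexity.
End CD.

Definition big_Omega (R : realType) (a b : R -> \bar R) : Prop :=
  exists c eps0 : R, [/\ 0 < c, 0 < eps0 &
    forall eps : R, 0 < eps <= eps0 -> (c%:E * b eps <= a eps)%E].

(* For p = 2 the exponent p (1 + p / (2 - p)) is +oo, so that its negative
   power of eps < 1 is +oo as well. *)
Definition approximation_rate (R : realType) (p eps : R) : \bar R :=
  if p == 2 then +oo%E else (eps `^ (- (p * (1 + p / (2 - p)))))%:E.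

(* Main.v *)
(** An algorithm for approximation with error e and cost m yields a randomized
    algorithm for integration by variance reduction: integrate the computed
    approximation g of f exactly and estimate the integral of f - g by Monte
    Carlo with n samples. Its cost is m + n and its error e / sqrt n (or e when
    n = 0), so that c (e / sqrt n)^(-p) <= m + n. For 0 < p < 2 the best n is of
    order e^(-2p / (2 - p)); for p > 2, or p = 2 and e small, letting n go to
    infinity forces m to be infinite. With g = 0 and m = 0 the latter shows that
    p <= 2 as soon as the expectation of the squared L2 norm is finite. *)
Require Import Defs.
From HB Require Import structures.
From mathcomp Require Import all_boot all_order all_algebra.
From mathcomp Require Import all_classical all_reals all_analysis.
From mathcomp Require Import measurable_realfun.
From mathcomp Require Import ring lra.

Set Implicit Arguments.
Unset Strict Implicit.
Unset Printing Implicit Defensive.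

Import Order.TTheory GRing.Theory Num.Theory.
Import numFieldNormedType.Exports.

Local Open Scope classical_set_scope.
Local Open Scope ring_scope.

(** * Independent samples and the mean square error of Monte Carlo *)

Section iid.
Context dT (T : measurableType dT) (R : realType) (P : probability T R).
Local Open Scope ereal_scope.

Definition tuple_cons n (z : T * n.-tuple T) : n.+1.-tuple T :=
  [the n.+1.-tuple T of z.1 :: z.2].

Lemma measurable_tuple_cons n : measurable_fun setT (@tuple_cons n).
Proof. exact: measurable_cons. Qed.

HB.instance Definition _ n :=
  isMeasurableFun.Build _ _ _ _ (@tuple_cons n) (@measurable_tuple_cons n).

Fixpoint iid n : probability (n.-tuple T) R :=
  match n with
  | 0 => \d_ [tuple]
  | n'.+1 => distribution (P \x iid n') (@tuple_cons n')
  end.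

Lemma integral_probability_cst (c : \bar R) : \int[P]_x c = c.
Proof.
by rewrite integral_cst// -[RHS]mule1; congr (_ * _); exact: probability_setT.
Qed.

Lemma integral_iid0 (f : 0.-tuple T -> \bar R) : measurable_fun setT f ->
  \int[iid 0]_xs f xs = f [tuple].
Proof. by move=> mf; rewrite integral_dirac// diracT mul1e. Qed.

Lemma integral_iidS n (f : n.+1.-tuple T -> \bar R) : measurable_fun setT f ->
  (forall xs, 0 <= f xs) ->
  \int[iid n.+1]_xs f xs = \int[P]_x \int[iid n]_xs f (tuple_cons (x, xs)).
Proof.
move=> mf f0; rewrite /= ge0_integral_distribution// fubini_tonelli1//=.
exact: (measurableT_comp mf (@measurable_tuple_cons n)).
Qed.

(** Expands the square. With [g] of mean [m], the case [b = - m] computes the variance, and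
    [b = a - m] drives the induction in [iid_second_moment]. *)
Lemma integral_sqr_shift (g : T -> R) (b : R) : g \in Lfun P 2%:E ->
  \int[P]_x ((b + g x) ^+ 2)%:E =
  (b ^+ 2 + 2 * b * (\int[P]_x g x)%R + (\int[P]_x (g x ^+ 2))%R)%:E.
Proof.
move=> g2.
have ig : P.-integrable setT (EFin \o g).
  by apply/Lfun1_integrable/Lfun_subset12 => //; exact: fin_num_measure.
have ig2 := Lfun2_integrable_sqr g2.
have i1 : P.-integrable setT (fun x => (2 * b)%:E * (g x)%:E).
  exact: integrableZl.
have i0 : P.-integrable setT (fun=> (b ^+ 2)%:E).
  exact: finite_measure_integrable_cst.
rewrite (eq_integral (fun x => (b ^+ 2)%:E + (2 * b)%:E * (g x)%:E +
    (g x ^+ 2)%:E)); last first.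
  by move=> x _; rewrite -EFinM -!EFinD; congr EFin; ring.
rewrite integralD//; last exact: integrableD.
rewrite integralD// integralZl// integral_probability_cst.
rewrite /Rintegral !EFinD !EFinM !fineK//; do ?exact: integrable_fin_num.
Qed.

Variable g : T -> R.
Hypothesis g2 : g \in Lfun P 2%:E.
Let m : R := (\int[P]_x g x)%R.
Let q : R := (\int[P]_x (g x ^+ 2))%R.

Let mg : measurable_fun setT g.
Proof. by move: g2; rewrite inE => /andP[]; rewrite inE. Qed.

Lemma sqr_Rintegral_le : (m ^+ 2 <= q)%R.
Proof.
have : 0 <= \int[P]_x ((- m + g x) ^+ 2)%:E.
  by apply: integral_ge0 => x _; rewrite lee_fin sqr_ge0.
by rewrite integral_sqr_shift// lee_fin -/m -/q => ?; nra.
Qed.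

Lemma measurable_iid_sum n (a : R) : measurable_fun setT
  (fun xs : n.-tuple T => ((a + \sum_(i < n) (g (tnth xs i) - m)) ^+ 2)%:E).
Proof.
apply/measurable_EFinP/measurable_funX/measurable_funD => //.
apply: measurable_sum => i; apply: measurable_funB => //.
by apply: measurableT_comp => //; exact: measurable_tnth.
Qed.

(** The centred samples are independent with mean zero, so cross terms vanish and variances add up.
    The offset [a] is general because the induction absorbs the first sample into it, using the
    hypothesis at [a + (g x - m)]. *)
Lemma iid_second_moment n (a : R) :
  \int[iid n]_xs ((a + \sum_(i < n) (g (tnth xs i) - m)) ^+ 2)%:E =
  (a ^+ 2 + n%:R * (q - m ^+ 2))%:E.
Proof.
elim: n a => [|n IHn] a.
  rewrite integral_iid0; last exact: measurable_iid_sum.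
  by rewrite big_ord0 addr0 mul0r addr0.
rewrite integral_iidS; last 2 first.
- exact: measurable_iid_sum.
- by move=> xs; rewrite lee_fin sqr_ge0.
rewrite (eq_integral (fun x =>
    ((a - m + g x) ^+ 2)%:E + (n%:R * (q - m ^+ 2))%:E)); last first.
  move=> x _; rewrite -EFinD -addrA [(- m + g x)%R]addrC -IHn.
  apply: eq_integral => xs _.
  rewrite big_ord_recl addrA; congr ((_ + _) ^+ 2)%:E.
  by apply: eq_bigr => i _; rewrite tnthS.
rewrite ge0_integralD//; last 3 first.
- by move=> x _; rewrite lee_fin sqr_ge0.
- by apply/measurable_EFinP/measurable_funX/measurable_funD.
- by move=> x _; rewrite lee_fin mulr_ge0// subr_ge0 sqr_Rintegral_le.
rewrite integral_sqr_shift// integral_probability_cst -EFinD -/m -/q -natr1.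
by congr EFin; ring.
Qed.

Definition monte_carlo_mean n (xs : n.-tuple T) : R :=
  (n%:R^-1 * \sum_(i < n) g (tnth xs i))%R.

Lemma measurable_monte_carlo_mean n :
  measurable_fun setT (@monte_carlo_mean n).
Proof.
apply: measurable_funM => //; apply: measurable_sum => i.
by apply: measurableT_comp => //; exact: measurable_tnth.
Qed.

(* For n = 0 the mean is 0 (as 0^-1 = 0) and the bound is Cauchy-Schwarz; hence
   the maximum with 1. *)
Lemma monte_carlo_error n :
  \int[iid n]_xs ((m - monte_carlo_mean xs) ^+ 2)%:E <=
  ((maxn 1 n)%:R^-1)%:E * \int[P]_x (g x ^+ 2)%:E.
Proof.
have fq : (\int[P]_x (g x ^+ 2)%:E = q%:E).
  rewrite fineK//; apply: integrable_fin_num => //.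
  exact: Lfun2_integrable_sqr.
rewrite fq -EFinM.
case: n => [|n].
  rewrite integral_iid0.
    rewrite /monte_carlo_mean big_ord0 mulr0 subr0 invr1 mul1r lee_fin.
    exact: sqr_Rintegral_le.
  apply/measurable_EFinP/measurable_funX/measurable_funB => //.
  exact: (@measurable_monte_carlo_mean 0).
(* Up to sign, the error of the mean is the centred sum divided by [n.+1], to which
   [iid_second_moment] applies with offset 0. *)
rewrite (eq_integral (fun xs : n.+1.-tuple T => (n.+1%:R^-2)%:E *
    ((0 + \sum_(i < n.+1) (g (tnth xs i) - m)) ^+ 2)%:E)); last first.
  move=> xs _; rewrite -EFinM; congr EFin.
  rewrite add0r sumrB sumr_const card_ord /monte_carlo_mean.
  rewrite -exprVn -exprMn mulrBr -(mulr_natl m) mulKf ?pnatr_eq0//.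
  by rewrite -sqrrN opprB.
rewrite ge0_integralZl//; last 2 first.
- exact: measurable_iid_sum.
- by move=> xs _; rewrite lee_fin sqr_ge0.
rewrite iid_second_moment -EFinM lee_fin maxnE subn1 add1n.
rewrite expr0n add0r /= mulrA.
have -> : (n.+1%:R ^- 2 * n.+1%:R = n.+1%:R^-1 :> R)%R.
  by rewrite expr2 invfM -mulrA mulVf ?pnatr_eq0// mulr1.
rewrite ler_wpM2l ?invr_ge0//.
(* The variance is at most the second moment [q]. *)
by rewrite gerBl sqr_ge0.
Qed.
End iid.

(** * Joint measurability of point evaluation and of parametric integrals *)

Section measurability.
Variables (R : realType) (d : nat).
Local Notation cube := (cube R d).
Local Notation CD := (CD R d).

Lemma open_cube_measurable (U : set cube) : open U -> measurable U.
Proof. exact: sub_sigma_algebra. Qed.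

Lemma open_CD_measurable (U : set CD) : open U -> measurable U.
Proof. exact: sub_sigma_algebra. Qed.

(** The complement is open in the sup norm: a value [f y < r] stays below [r] under any perturbation
    smaller than [r - f y]. *)
Lemma lower_bound_on_measurable (U : set cube) (r : R) :
  measurable [set f : CD | forall y, U y -> r <= f y].
Proof.
rewrite -[X in measurable X]setCK; apply: measurableC.
apply: open_CD_measurable; apply/CD_openP => f /existsNP[y /not_implyP[Uy]].
move=> /negP; rewrite -ltNge => fyr.
exists (r - f y) => [|g fg /(_ y Uy)]; first by rewrite subr_gt0.
by have := fg y; rewrite ltr_norml => /andP[+ _]; lra.
Qed.

Definition rational_ball (q : 'rV[rat]_d * nat) : set cube :=
  [set x | ball (map_mx ratr q.1 : 'rV[R]_d) q.2.+1%:R^-1 (set_val x)].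

Lemma rational_ball_measurable q : measurable (rational_ball q).
Proof.
apply: open_cube_measurable.
move/continuousP : (@set_val_continuous R d); apply.
exact: ball_open.
Qed.

Lemma rational_ball_basis (x : cube) (V : set cube) : nbhs x V ->
  exists2 q, rational_ball q x & rational_ball q `<=` V.
Proof.
move=> xV.
(* The neighbourhood is pulled back along the retraction [clamp] to the whole row space, where balls
   are available. *)
have : nbhs (set_val x : 'rV[R]_d) (@clamp R d @^-1` V).
  by apply: clamp_continuous; rewrite clamp_rowK.
move=> /nbhs_ballP[e /= e0 eV].
pose n := Num.truncn (2 / e).
have ne : n.+1%:R^-1 < e / 2.
  by rewrite -[e / 2]invf_div ltf_pV2 ?posrE ?divr_gt0// truncnS_gt.
have n0 : 0 < n.+1%:R^-1 :> R by rewrite invr_gt0.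
pose c i := (set_val x : 'rV[R]_d) ord0 i.
have /choice[q qc] : forall i, exists q : rat, `|ratr q - c i| < n.+1%:R^-1.
  move=> i; have [|q] := @rat_in_itvoo R (c i - n.+1%:R^-1) (c i + n.+1%:R^-1).
    by move: n0; move: (_^-1) => r r0; lra.
  by rewrite in_itv/= -ltr_distlC distrC; exists q.
have xq : ball (\row_i ratr (q i) : 'rV[R]_d) n.+1%:R^-1 (set_val x).
  by split=> // i j; rewrite !ord1 mxE; exact: qc.
have qE : map_mx ratr (\row_i q i) = \row_i ratr (q i) :> 'rV[R]_d.
  by apply/rowP => i; rewrite !mxE.
exists (\row_i q i, n) => [|y]; rewrite /rational_ball/= qE// => yq.
 rewrite -(clamp_rowK y); apply: eV; apply: le_ball (ltW _) _ _.
  by rewrite [e]splitr; apply: ltrD; exact: ne.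
by apply: ball_triangle yq; exact: ball_sym.
Qed.

(** By continuity, [f x > a] holds exactly when, for some [n], [f] is at least [a + 1 / (n + 1)] on
    a rational ball containing [x]. The preimage is thus a countable union of measurable
    rectangles. *)
Lemma measurable_evaluation :
  measurable_fun setT (fun z : CD * cube => z.1 z.2).
Proof.
apply: (measurability _ (RGenOInfty.measurableE R)) => _ [_ [a ->] <-].
rewrite setTI.
rewrite (_ : _ @^-1` _ = \bigcup_(q : 'rV[rat]_d * nat) \bigcup_(n : nat)
  ([set f : CD | forall y, rational_ball q y -> a + n.+1%:R^-1 <= f y] `*`
   rational_ball q)); last first.
  rewrite eqEsubset; split=> -[f x] /=; last first.
    move=> [q _ [n _ [/= fq qx]]]; rewrite in_itv/= andbT.
    by apply: lt_le_trans (fq _ qx); rewrite ltrDl invr_gt0.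
  rewrite in_itv/= andbT => afx.
  pose n := Num.truncn (2 / (f x - a)).
  have e0 : 0 < f x - a by rewrite subr_gt0.
  have ne : n.+1%:R^-1 < (f x - a) / 2.
    by rewrite -[_ / 2]invf_div ltf_pV2 ?posrE ?divr_gt0// truncnS_gt.
  have : nbhs x [set y | a + n.+1%:R^-1 < f y].
    apply: (@cts_fun _ _ f x [set z | a + n.+1%:R^-1 < z]).
    apply: open_nbhs_nbhs; split; [exact: open_gt|].
    by move: ne; rewrite /=; move: (n.+1%:R^-1) => r; lra.
  move=> /rational_ball_basis[q qx qV].
  by exists q => //; exists n => //; split=> //= y /qV /ltW.
apply: countable_bigcupT_measurable => // q.
apply: bigcupT_measurable => n.
apply: measurableX; first exact: lower_bound_on_measurable.
exact: rational_ball_measurable.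
Qed.

(** Tonelli covers the integrals of the positive and negative parts; their difference, and then
    [fine], preserve measurability. *)
Lemma measurable_fun_param_Rintegral dX (X : measurableType dX)
    dY (Y : measurableType dY) (P : probability Y R) (F : X * Y -> R) :
  measurable_fun setT F ->
  measurable_fun setT (fun x => \int[P]_y F (x, y)).
Proof.
move=> mF; apply: (measurableT_comp (fine_measurable measurableT)).
have mE : measurable_fun setT (EFin \o F) by exact/measurable_EFinP.
rewrite (_ : (fun x => _) = fun x => (fubini_F P (EFin \o F)^\+ x -
  fubini_F P (EFin \o F)^\- x)%E).
  apply: emeasurable_funB; apply: measurable_fun_fubini_tonelli_F => //.
  - exact: measurable_funepos.
  - exact: measurable_funeneg.
apply/funext => x; rewrite [LHS]integralE /fubini_F.
by congr (_ - _)%E; apply: eq_integral => y _; rewrite ?funeposE ?funenegE.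
Qed.

End measurability.

(** * Comparison of iterated integrals *)

Section iterated_integral.
Context dX (X : measurableType dX) dS (S : measurableType dS)
  dT (T : measurableType dT) (R : realType).
Variables (nu : probability X R) (P : probability S R) (Q : probability T R).
Local Open Scope ereal_scope.

(** To be used with [D] the squared integration error, [Z] the squared approximation error and [w]
    the variance reduction factor. After Tonelli, the innermost bound is integrated over [s], then
    over [x]. *)
Lemma iterated_integral_le (D : X * (S * T) -> \bar R) (Z : X * S -> \bar R)
    (w : R) : (0 <= w)%R ->
  measurable_fun setT D -> (forall z, 0 <= D z) ->
  measurable_fun setT Z -> (forall z, 0 <= Z z) ->
  (forall x s, \int[Q]_t D (x, (s, t)) <= w%:E * Z (x, s)) ->
  \int[nu]_x \int[P \x Q]_z D (x, z) <= w%:E * \int[nu]_x \int[P]_s Z (x, s).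
Proof.
move=> w0 mD D0 mZ Z0 DZ.
have mZf : measurable_fun setT (fun x => \int[P]_s Z (x, s)).
  exact: (measurable_fun_fubini_tonelli_F Z).
rewrite -ge0_integralZl//; last by move=> x _; exact: integral_ge0.
apply: ge0_le_integral => //.
- by move=> x _; exact: integral_ge0.
- pose PQ : probability (S * T)%type R := (P \x Q).
  exact: (@measurable_fun_fubini_tonelli_F _ _ _ _ _ PQ D).
- exact: measurable_funeM.
move=> x _.
have mZft : measurable_fun setT (fun s => Z (x, s)).
  exact: measurable_fun_pair2.
have mDft : measurable_fun setT (fun z => D (x, z)).
  exact: measurable_fun_pair2.
rewrite fubini_tonelli1// -ge0_integralZl//.
apply: ge0_le_integral => //.
- by move=> s _; exact: integral_ge0.
- exact: (measurable_fun_fubini_tonelli_F (fun z => D (x, z))).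
- exact: measurable_funeM.
- by move=> s _; exact: DZ.
Qed.

End iterated_integral.

(** * Integration with an approximation as control variate *)

Section control_variate.
Variables (R : realType) (d : nat) (A : algorithm (L2_approximation R d)).
Variable n : nat.
Local Notation cube := (cube R d).
Local Notation CD := (CD R d).
Local Notation mu := (cube_measure R d).

(* The n Monte Carlo values come first, so that the values seen by A are those
   remaining after dropping n. *)
Definition cv_query (t : seed A * n.-tuple cube) (y : seq R) : option cube :=
  if (size y < n)%N then Some (nth point t.2 (size y))
  else query t.1 (drop n y).

Definition cv_output (t : seed A * n.-tuple cube) (y : seq R) : R :=
  let g := output t.1 (drop n y) : L2 R d in
  (\int[mu]_x (g x) +
   n%:R^-1 * \sum_(i < n) (nth 0 y i - g (tnth t.2 i)))%R.

Lemma observe_cv_prefix f t k : (k <= n)%N ->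
  observe (cv_query t) f k = [seq f x | x <- take k t.2].
Proof.
elim: k => [|k IHk] kn; first by rewrite take0.
rewrite /observe iterS -/(observe _ _ _) IHk ?(ltnW kn)//.
rewrite /cv_query size_map size_takel ?size_tuple ?(ltnW kn)// kn.
by rewrite (take_nth point) ?size_tuple// map_rcons.
Qed.

Lemma observe_cv f t k :
  observe (cv_query t) f (n + k) =
  [seq f x | x <- t.2] ++ observe (query t.1) f k.
Proof.
elim: k => [|k IHk].
  by rewrite addn0 observe_cv_prefix// take_oversize ?size_tuple// cats0.
rewrite addnS /observe !iterS -!/(observe _ _ _) IHk /cv_query.
rewrite size_cat size_map size_tuple ltnNge leq_addr/=.
rewrite drop_size_cat ?size_map ?size_tuple//.
by case: (query _ _) => // x; rewrite rcons_cat.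
Qed.

Lemma cv_query_prefix f t k : (k < n)%N ->
  cv_query t (observe (cv_query t) f k).
Proof.
move=> kn; rewrite observe_cv_prefix ?(ltnW kn)// /cv_query.
by rewrite size_map size_takel ?size_tuple ?(ltnW kn)// kn.
Qed.

Lemma cv_query_suffix f t k :
  cv_query t (observe (cv_query t) f (n + k)) =
  query t.1 (observe (query t.1) f k).
Proof.
rewrite observe_cv /cv_query size_cat size_map size_tuple ltnNge leq_addr/=.
by rewrite drop_size_cat ?size_map ?size_tuple.
Qed.

Lemma cv_query_halts f t :
  exists k, ~~ cv_query t (observe (cv_query t) f k).
Proof.
by have [k hk] := query_halts f t.1; exists (n + k)%N; rewrite cv_query_suffix.
Qed.

(** No halt can occur in the first [n] rounds, and from then on the queries are those of [A], so the
    least halting times differ by [n]. *)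
Lemma cv_cardinality f t :
  ex_minn (cv_query_halts f t) = (n + cardinality f t.1)%N.
Proof.
rewrite /cardinality; case: ex_minnP => m hm m_min.
case: ex_minnP => k hk k_min.
have nm : (n <= m)%N.
  by rewrite leqNgt; apply/negP => /(cv_query_prefix f t); rewrite (negbTE hm).
apply/eqP; rewrite eqn_leq m_min ?cv_query_suffix//=.
by rewrite -leq_subRL// k_min// -cv_query_suffix subnKC.
Qed.

Lemma cv_information f t :
  observe (cv_query t) f (ex_minn (cv_query_halts f t)) =
  [seq f x | x <- t.2] ++ information f t.1.
Proof. by rewrite cv_cardinality observe_cv. Qed.

Definition approximant (f : CD) (t : seed A) : L2 R d :=
  output t (information f t).

Definition residual (f : CD) (t : seed A) (x : cube) : R :=
  f x - approximant f t x.

Lemma residual_Lfun (f : CD) t : residual f t \in Lfun mu 2%:E.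
Proof.
exact: (LfunP (CD_L2 f - approximant f t)).
Qed.

(** Subtracting the exact integral of the approximant turns the integral of [f] into that of the
    residual; the sum in [cv_output] is the Monte Carlo mean of the residual. *)
Lemma cv_error (f : CD) t :
  (\int[mu]_x f x -
    cv_output t (observe (cv_query t) f (ex_minn (cv_query_halts f t))) =
  \int[mu]_x residual f t.1 x - monte_carlo_mean (residual f t.1) t.2)%R.
Proof.
rewrite cv_information /cv_output drop_size_cat ?size_map ?size_tuple//.
rewrite -/(approximant f t.1); set g := approximant f t.1.
(* Square-integrable functions are integrable for a probability, so the integral of the residual
   splits. *)
have iL (h : L2 R d) : mu.-integrable setT (EFin \o h).
  apply/Lfun1_integrable/Lfun_subset12; first exact: fin_num_measure.
  exact: LfunP.
rewrite [X in _ = X - _](_ : _ = \int[mu]_x f x - \int[mu]_x g x)%R; last first.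
  by rewrite -RintegralB//; exact: (iL (CD_L2 f)).
rewrite /monte_carlo_mean opprD addrA; congr (_ - _); congr (_ * _)%R.
apply: eq_bigr => i _; congr (_ - _).
rewrite nth_cat size_map size_tuple ltn_ord (nth_map point) ?size_tuple//.
by rewrite -tnth_nth.
Qed.

Lemma measurable_residual : measurable_fun setT
  (fun z : (CD * seed A) * cube => residual z.1.1 z.1.2 z.2).
Proof.
apply: measurable_funB; last exact: (measurable_output A).
apply: (measurableT_comp (@measurable_evaluation R d)
  (_ : measurable_fun setT (fun z : (CD * seed A) * cube => (z.1.1, z.2)))).
apply: measurable_fun_pair => //.
exact: (measurableT_comp measurable_fst).
Qed.

Let mh : measurable_fun setT
  (fun z : CD * (seed A * n.-tuple cube) => (z.1, z.2.1)).
Proof.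
by apply: measurable_fun_pair => //; exact: (measurableT_comp measurable_fst).
Qed.

Lemma measurable_cv_cardinality : measurable_fun setT
  (fun z : CD * (seed A * n.-tuple cube) => ex_minn (cv_query_halts z.1 z.2)).
Proof.
rewrite (_ : (fun _ => _) = (fun z => n + cardinality z.1 z.2.1)%N); last first.
  by apply/funext => z; rewrite cv_cardinality.
have ma : measurable_fun setT (addn n) by [].
have mc := @measurable_cardinality R d _ A.
exact: (measurableT_comp ma (measurableT_comp mc mh)).
Qed.

Definition cv_deviation (z : CD * (seed A * n.-tuple cube)) : R :=
  \int[mu]_x residual z.1 z.2.1 x -
  monte_carlo_mean (residual z.1 z.2.1) z.2.2.

Lemma measurable_cv_deviation : measurable_fun setT cv_deviation.
Proof.
apply: measurable_funB.
  exact: (measurableT_comp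
    (measurable_fun_param_Rintegral mu measurable_residual) mh).
apply: measurable_funM => //; apply: measurable_sum => i.
pose k (z : CD * (seed A * n.-tuple cube)) := ((z.1, z.2.1), tnth z.2.2 i).
apply: (measurableT_comp measurable_residual (_ : measurable_fun setT k)).
apply: measurable_fun_pair => //.
apply: (measurableT_comp (measurable_tnth i)).
exact: (measurableT_comp measurable_snd).
Qed.

(** Measurability of the output of [A] is known only along the values that [A] gathers, so the new
    output is written through [cv_error] as the integral of [f] minus a measurable deviation. *)
Lemma measurable_cv_output : measurable_fun setT
  (fun z : CD * (seed A * n.-tuple cube) => cv_output z.2
    (observe (cv_query z.2) z.1 (ex_minn (cv_query_halts z.1 z.2)))).
Proof.
rewrite (_ : (fun _ => _) = (fun z : CD * (seed A * n.-tuple cube) =>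
    \int[mu]_x z.1 x - cv_deviation z));
  last by apply/funext => z; rewrite /cv_deviation -cv_error subKr.
apply: measurable_funB; last exact: measurable_cv_deviation.
exact: (measurableT_comp
  (measurable_fun_param_Rintegral mu (@measurable_evaluation R d))).
Qed.

Definition control_variate : algorithm (integration R d) :=
  @Algorithm R d (integration R d) _ (seed A * n.-tuple cube)%type
   (seed_law A \x iid mu n)%E cv_query cv_output cv_query_halts
   measurable_cv_cardinality measurable_cv_output.

Local Open Scope ereal_scope.

Lemma control_variate_cost nu :
  avg_cost nu control_variate = n%:R%:E + avg_cost nu A.
Proof.
pose c (z : CD * seed A) : \bar R := (cardinality z.1 z.2)%:R%:E.
have mc : measurable_fun setT c.
  have m1 : measurable_fun setT (fun k : nat => k%:R%:E : \bar R) by [].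
  have m2 := @measurable_cardinality R d _ A.
  exact: (measurableT_comp m1 m2).
have c0 z : 0 <= c z by rewrite lee_fin.
have mcf f : measurable_fun setT (fun t => c (f, t)).
  exact: measurable_fun_pair2.
transitivity (\int[nu]_f (n%:R%:E + \int[seed_law A]_t c (f, t))).
  apply: eq_integral => f _.
  transitivity (\int[(seed_law A \x iid mu n)]_t (n%:R%:E + c (f, t.1))).
    apply: eq_integral => t _.
    rewrite -[cardinality _ _]/(ex_minn (cv_query_halts f t)) cv_cardinality.
    by rewrite natrD EFinD.
  rewrite fubini_tonelli1; last 2 first.
  - apply: emeasurable_funD => //.
    exact: (measurableT_comp (mcf f) measurable_fst).
  - by move=> t; rewrite adde_ge0// lee_fin.
  (* The sample points do not affect the cardinality, so the integral over them is that of a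
     constant. *)
  rewrite /fubini_F; under eq_integral do rewrite /= integral_probability_cst.
  by rewrite ge0_integralD// ?integral_probability_cst.
rewrite ge0_integralD//; first by rewrite integral_probability_cst.
- by move=> f _; exact: integral_ge0.
- exact: (measurable_fun_fubini_tonelli_F c).
Qed.

(** Elements of [L2] have finite norm, which allows the integer square to be exchanged with the real
    power in the definition of the norm. *)
Lemma L2_norm_residual f t :
  codomain_norm (solution (L2_approximation R d) f - output t (information f t))
    ^+ 2 = \int[mu]_x (residual f t x ^+ 2)%:E.
Proof.
pose g : L2 R d := (CD_L2 f - approximant f t)%R.
rewrite -[codomain_norm _]/('N[mu]_2%:E[EFin \o g]).
rewrite -finite_norm_fine -EFin_expe -powR_mulrn ?fine_ge0 ?Lnorm_ge0//.
rewrite -poweR_EFin finite_norm_fine poweR_Lnorm//.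
apply: eq_integral => x _; rewrite /= powR_mulrn//.
by rewrite real_normK// num_real.
Qed.

(** For fixed [f] and fixed seed of [A] the approximant is fixed, so [monte_carlo_error] applies to
    the residual; [iterated_integral_le] then averages this bound over both. *)
Lemma control_variate_error nu (e : R) : (0 <= e)%R ->
  avg_error nu A <= e%:E ->
  avg_error nu control_variate <= (e / Num.sqrt (maxn 1 n)%:R)%:E.
Proof.
move=> e0.
rewrite /avg_error.
set w : R := ((maxn 1 n)%:R^-1)%R.
have w0 : (0 <= w)%R by rewrite invr_ge0.
have -> : (e / Num.sqrt (maxn 1 n)%:R)%:E = sqrte ((w * e ^+ 2)%:E).
  by rewrite /= sqrtrM// sqrtr_sqr ger0_norm// mulrC /w sqrtrV.
have -> : e%:E = sqrte ((e ^+ 2)%:E) by rewrite /= sqrtr_sqr ger0_norm.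
rewrite !lee_sqrt ?lee_fin ?mulr_ge0 ?sqr_ge0//.
pose Z z := fubini_F mu (fun z : (CD * seed A) * cube =>
  (residual z.1.1 z.1.2 z.2 ^+ 2)%:E) z.
have mZ : measurable_fun setT Z.
  apply: measurable_fun_fubini_tonelli_F => [|z];
    last by rewrite lee_fin sqr_ge0.
  by apply/measurable_EFinP/measurable_funX; exact: measurable_residual.
have Z0 z : 0 <= Z z by apply: integral_ge0 => x _; rewrite lee_fin sqr_ge0.
pose D z := (cv_deviation z ^+ 2)%:E.
have mD : measurable_fun setT D.
  by apply/measurable_EFinP/measurable_funX; exact: measurable_cv_deviation.
have D0 z : 0 <= D z by rewrite lee_fin sqr_ge0.
have -> : \int[nu]_f \int[seed_law A]_t
    codomain_norm (solution (L2_approximation R d) f -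
      output t (information f t)) ^+ 2 =
    \int[nu]_f \int[seed_law A]_t Z (f, t).
  apply: eq_integral => f _; apply: eq_integral => t _.
  exact: L2_norm_residual.
have -> : \int[nu]_f \int[seed_law control_variate]_t codomain_norm
     (solution (integration R d) f - output t (information f t)) ^+ 2 =
   \int[nu]_f \int[seed_law A \x iid mu n]_t D (f, t).
  apply: eq_integral => f _; apply: eq_integral => t _.
  by rewrite /D /cv_deviation -cv_error -real_normK ?num_real// EFin_expe.
move=> Ze; apply: (@le_trans _ _
  (w%:E * \int[nu]_f \int[seed_law A]_t Z (f, t))); last first.
  by rewrite EFinM lee_wpmul2l ?lee_fin.
apply: iterated_integral_le => // f t.
rewrite /D /Z /cv_deviation /fubini_F /=.
exact: (monte_carlo_error (residual_Lfun f t) n).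
Qed.

End control_variate.

(** * Choice of the sample size *)

Section rates.
Variables (R : realType) (c p : R).
Hypothesis c_gt0 : 0 < c.

Lemma powR_div_sqrt (e : R) (n : nat) : 0 < e -> (0 < n)%N ->
  (e / Num.sqrt n%:R) `^ (- p) = e `^ (- p) * n%:R `^ (p / 2).
Proof.
move=> e_gt0 n_gt0.
rewrite powRM ?(ltW e_gt0)// ?invr_ge0// -powR12_sqrt// -powRN -powRrM.
by congr (_ * _ `^ _); field.
Qed.

(** The right-hand side is of order n^(p/2), which outgrows n if [p > 2]; for [p = 2] both sides are
    linear in n and the smallness of [e] settles the constant. The factor 2 leaves n once the cost n
    of the samples is subtracted. *)
Lemma eventually_ge_double (e : R) : 0 < e ->
  2 < p \/ p = 2 /\ e ^+ 2 <= c / 2 ->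
  exists N, forall n, (N <= n)%N ->
    2 * n%:R <= c * (e / Num.sqrt (maxn 1 n)%:R) `^ (- p).
Proof.
move=> e_gt0 hp.
suff [N hN] : exists N, forall n, (N <= n)%N -> (0 < n)%N ->
    2 <= c * e `^ (- p) * n%:R `^ (p / 2 - 1).
  exists N.+1 => n Nn; have n_gt0 : (0 < n)%N by exact: leq_trans Nn.
  rewrite (maxn_idPr n_gt0) powR_div_sqrt// mulrA.
  have -> : n%:R `^ (p / 2) = n%:R `^ (p / 2 - 1) * n%:R :> R.
    rewrite -[X in _ = _ * X]powRr1// -powRD;
      last by rewrite pnatr_eq0 -lt0n n_gt0 implybT.
    by rewrite subrK.
  by rewrite mulrA ler_wpM2r// hN// ltnW.
case: hp => [p_gt2|[-> e2]]; last first.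
  exists 0 => n _ n_gt0; rewrite mulfV// subrr powRr0 mulr1.
  rewrite powRN powR_mulrn ?(ltW e_gt0)//.
    by rewrite ler_pdivlMr ?exprn_gt0//; lra.
pose r := p / 2 - 1; have r_gt0 : 0 < r by rewrite /r; lra.
pose K := c * e `^ (- p); have K_gt0 : 0 < K by rewrite mulr_gt0// powR_gt0.
(* From this threshold on, n^r is at least [2 / K]. *)
exists (Num.truncn ((2 / K) `^ r^-1)).+1 => n Nn n_gt0; rewrite -/K -/r.
rewrite mulrC -ler_pdivrMr//.
have -> : 2 / K = ((2 / K) `^ r^-1) `^ r.
  by rewrite -powRrM mulVf ?gt_eqF// powRr1// divr_ge0 ?(ltW K_gt0).
apply: ge0_ler_powR; rewrite ?nnegrE ?powR_ge0// ?(ltW r_gt0)//.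
by apply: le_trans (ltW (truncnS_gt _)) _; rewrite ler_nat.
Qed.

(* With s = p (1 + p / (2 - p)) = p + s p / 2, the choice n ~ k e^(-s) makes
   both n and e^(-p) n^(p/2) of order e^(-s). *)
Lemma balanced_sample_size : 0 < p -> p < 2 ->
  exists k e1 : R, [/\ 0 < k, 0 < e1 & forall e, 0 < e <= e1 ->
    exists n, n%:R + k * e `^ (- (p * (1 + p / (2 - p)))) <=
      c * (e / Num.sqrt (maxn 1 n)%:R) `^ (- p)].
Proof.
move=> p_gt0 p_lt2; set s := p * _.
have p2 : 2 - p != 0 by rewrite gt_eqF// subr_gt0.
have s_gt0 : 0 < s by rewrite mulr_gt0// addr_gt0// divr_gt0// subr_gt0.
(* [k] solves k = (c/4) k^(p/2). In 4 = 2 * 2, one factor pays for the two summands, each at most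
   [X], and the other for replacing [n] by [X / 2]. *)
pose k := (c / 4) `^ (1 - p / 2)^-1.
have p2' : 1 - p / 2 != 0 by rewrite gt_eqF//; lra.
have k_gt0 : 0 < k by rewrite powR_gt0// divr_gt0.
have kE : k `^ (1 - p / 2) = c / 4.
  by rewrite -powRrM mulVf// powRr1// divr_ge0// ltW.
(* This bound on [e] ensures [1 <= X], so that the integer part of [X] is positive and at least
   [X / 2]. *)
exists k, (k `^ s^-1); split=> //; first by rewrite powR_gt0.
move=> e /andP[e_gt0 ee1].
pose X := k * e `^ (- s).
have X_ge1 : 1 <= X.
  rewrite /X powRN ler_pdivlMr ?powR_gt0// mul1r.
  have -> : k = (k `^ s^-1) `^ s.
    by rewrite -powRrM mulVf ?gt_eqF// powRr1// ltW.
  by apply: ge0_ler_powR; rewrite ?nnegrE ?powR_ge0// ltW.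
exists (Num.truncn X); set n := Num.truncn X.
have n_gt0 : (0 < n)%N by rewrite truncn_gt0.
have nX : n%:R <= X by rewrite truncn_le; lra.
have Xn : X / 2 <= n%:R.
  have : X < n.+1%:R by exact: truncnS_gt.
  have : 1 <= n%:R :> R by rewrite ler1n.
  by rewrite -natr1; lra.
rewrite (maxn_idPr n_gt0) powR_div_sqrt// -/X.
apply: (@le_trans _ _ (X + X)); first by rewrite lerD2r.
apply: (@le_trans _ _ (c * (e `^ (- p) * (X / 2) `^ (p / 2)))); last first.
  rewrite ler_pM2l// ler_pM2l ?powR_gt0//.
  apply: ge0_ler_powR => //; rewrite ?nnegrE//; first by lra.
  by rewrite divr_ge0//; lra.
have X0 : 0 <= X by lra.
rewrite powRM//.
rewrite {1}/X powRM ?powR_ge0//.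
rewrite -powRrM.
(* The equation characterizing [s]: it turns e^(-p) e^(-sp/2) into e^(-s). *)
have hs : - s = - p + - s * (p / 2) by rewrite /s; field.
have eE : e `^ (- s) = e `^ (- p) * e `^ (- s * (p / 2)).
  by rewrite -powRD ?(gt_eqF e_gt0) ?implybT// -hs.
rewrite [c * _](_ : _ =
  c * k `^ (p / 2) * 2^-1 `^ (p / 2) * e `^ (- s)); last by rewrite eE; ring.
have kk : k = k `^ (p / 2) * (c / 4).
  by rewrite -kE -powRD ?(gt_eqF k_gt0) ?implybT// addrC subrK powRr1// ltW.
have h2 : 2^-1 <= 2^-1 `^ (p / 2) :> R by apply: ger1_powR; lra.
rewrite /X -mulrDl ler_pM2r ?powR_gt0// [in leLHS]kk.
have kp : 0 < k `^ (p / 2) by rewrite powR_gt0.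
apply: (@le_trans _ _ (c * k `^ (p / 2) * 2^-1)); first by lra.
by rewrite ler_pM2l// mulr_gt0.
Qed.

End rates.

(** * The zero approximation, without function values *)

Section no_information.
Variables (R : realType) (d : nat).
Local Notation cube := (cube R d).
Local Notation CD := (CD R d).

Definition null_query (t : unit) (y : seq R) : option cube := None.

Lemma null_query_halts (f : CD) t :
  exists k, ~~ null_query t (observe (null_query t) f k).
Proof. by exists 0. Qed.

Lemma null_cardinality f t : ex_minn (null_query_halts f t) = 0.
Proof. by case: ex_minnP => m _ /(_ 0 isT); rewrite leqn0 => /eqP. Qed.

Lemma measurable_null_cardinality : measurable_fun setT
  (fun z : CD * unit => ex_minn (null_query_halts z.1 z.2)).
Proof.
rewrite (_ : (fun _ => _) = cst 0)//.
by apply/funext => z; rewrite null_cardinality.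
Qed.

Lemma measurable_null_output : measurable_fun setT
  (fun z : (CD * unit) * cube => (0 : L2 R d) z.2).
Proof.
have m0 : measurable_fun setT ((0 : L2 R d) : cube -> R).
  by have := LfunP (0 : L2 R d); rewrite inE => /andP[]; rewrite inE.
exact: (measurableT_comp m0 measurable_snd).
Qed.

Definition no_information : algorithm (L2_approximation R d) :=
  @Algorithm R d (L2_approximation R d) _ unit \d_tt
    null_query (fun _ _ => 0 : L2 R d) null_query_halts
    measurable_null_cardinality measurable_null_output.

Local Open Scope ereal_scope.

Lemma no_information_cost nu : avg_cost nu no_information = 0.
Proof.
rewrite /avg_cost; apply: integral0_eq => f _; apply: integral0_eq => t _.
by rewrite -[cardinality _ _]/(ex_minn (null_query_halts f t)) null_cardinality.
Qed.

Lemma no_information_error nu : avg_error nu no_information =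
  sqrte (\int[nu]_f (codomain_norm (solution (L2_approximation R d) f)) ^+ 2).
Proof.
rewrite /avg_error; congr sqrte; apply: eq_integral => f _.
rewrite [X in integral _ _ X](_ : _ =
    cst ((codomain_norm (solution (L2_approximation R d) f)) ^+ 2)); last first.
  by apply/funext => t; rewrite -[output _ _]/(0 : L2 R d)%R subr0.
exact: integral_probability_cst.
Qed.

End no_information.

(** * Lower bounds carried over from integration to approximation *)

Section transfer.
Variables (R : realType) (d : nat) (nu : probability (CD R d) R).
Local Open Scope ereal_scope.

Lemma complexity_transfer (A : algorithm (L2_approximation R d)) n (e : R) :
  (0 <= e)%R -> avg_error nu A <= e%:E ->
  avg_complexity (integration R d) nu (e / Num.sqrt (maxn 1 n)%:R) <=
  n%:R%:E + avg_cost nu A.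
Proof.
move=> e0 Ae; apply: ereal_inf_lbound; exists (control_variate A n).
  exact: control_variate_error.
by rewrite control_variate_cost.
Qed.

Variables (c e0 p : R).
Hypotheses (c_gt0 : (0 < c)%R) (e0_gt0 : (0 < e0)%R).
Hypothesis Int_lower : forall e : R, (0 < e <= e0)%R ->
  c%:E * (e `^ (- p))%:E <= avg_complexity (integration R d) nu e.

Lemma sample_size_bound (A : algorithm (L2_approximation R d)) n (e : R) :
  (0 < e)%R -> (e / Num.sqrt (maxn 1 n)%:R <= e0)%R -> avg_error nu A <= e%:E ->
  (c * (e / Num.sqrt (maxn 1 n)%:R) `^ (- p))%:E <= n%:R%:E + avg_cost nu A.
Proof.
move=> e_gt0 ee0 Ae; apply: le_trans (complexity_transfer n (ltW e_gt0) Ae).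
rewrite EFinM; apply: Int_lower.
by rewrite ee0 andbT divr_gt0// sqrtr_gt0 ltr0n leq_max.
Qed.

(** For all large [n] the lower bound for integration yields 2n <= n + cost, so the cost is at least
    every such [n]. *)
Lemma avg_cost_infinite (A : algorithm (L2_approximation R d)) (e : R) :
  (0 < e)%R -> (2 < p)%R \/ p = 2%R /\ (e ^+ 2 <= c / 2)%R ->
  avg_error nu A <= e%:E -> avg_cost nu A = +oo.
Proof.
move=> e_gt0 hp Ae; have [N hN] := eventually_ge_double c_gt0 e_gt0 hp.
(* Beyond [M] the growth estimate holds and e / sqrt n is at most [e0], where the bound for
   integration is available. *)
pose M := (maxn N (Num.truncn ((e / e0) ^+ 2)).+1).
have cost_ge n : (M <= n)%N -> n%:R%:E <= avg_cost nu A.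
  rewrite geq_max => /andP[Nn en].
  have e_small : (e / Num.sqrt (maxn 1 n)%:R <= e0)%R.
    have n_gt0 : (0 < n)%N by exact: leq_trans en.
    rewrite (maxn_idPr n_gt0) ler_pdivrMr ?sqrtr_gt0 ?ltr0n// mulrC.
    rewrite -ler_pdivrMr// -[leLHS]ger0_norm;
      last by rewrite divr_ge0 ?(ltW e_gt0) ?(ltW e0_gt0).
    rewrite -sqrtr_sqr.
    by rewrite ler_sqrt// (le_trans (ltW (truncnS_gt _)))// ler_nat.
  have := sample_size_bound e_gt0 e_small Ae.
  have := hN _ Nn; move: (c * _)%R => B; case: (avg_cost nu A) => [r||].
  - by rewrite -EFinD !lee_fin; lra.
  - by move=> *; rewrite leey.
  - by move=> _; rewrite addeNy leeNy_eq.
(* This instance excludes the value [-oo]. *)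
have : M%:R%:E <= avg_cost nu A by exact: cost_ge.
move: cost_ge; case: (avg_cost nu A) => [r|//|_]; last by rewrite leeNy_eq.
move=> /(_ (maxn M (Num.truncn r).+1) (leq_maxl _ _)).
rewrite lee_fin => Mr _; have := truncnS_gt r.
rewrite ltNge => /negP[]; apply: le_trans Mr.
by rewrite ler_nat leq_maxr.
Qed.

Lemma approximation_lower :
  big_Omega (avg_complexity (L2_approximation R d) nu) (approximation_rate p).
Proof.
rewrite /approximation_rate.
have [p_le0|p_gt0] := leP p 0%R.
  (* The rate is bounded, and the complexity of integration already bounded
     away from 0: no Monte Carlo sample is taken. *)
  exists (c * e0 `^ (- p))%R, (Num.min e0 1)%R; split.
  - by rewrite mulr_gt0// powR_gt0.
  - by rewrite lt_min e0_gt0 ltr01.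
  move=> e /andP[e_gt0]; rewrite le_min => /andP[ee0 e_le1].
  apply/ereal_infP => _ [A Ae ->]; rewrite ifF; last by apply/eqP; lra.
  have := @sample_size_bound A 0 e0 e0_gt0.
  rewrite sqrtr1 divr1 add0e => /(_ (lexx _)) A_ge.
  apply: (le_trans _ (A_ge _)); last by rewrite (le_trans Ae)// lee_fin.
  rewrite -EFinM lee_fin ler_piMr ?mulr_ge0 ?powR_ge0 ?(ltW c_gt0)//.
  rewrite -[leRHS](powRr0 e); apply: ger_powR; first by rewrite e_gt0.
  (* In this form the exponent visibly has the sign of [p], so the rate is at most 1 for
     [e <= 1]. *)
  have -> : (p * (1 + p / (2 - p)) = p * (2 / (2 - p)))%R.
    by field; rewrite gt_eqF//; lra.
  by rewrite oppr_ge0 mulr_le0_ge0// divr_ge0//; lra.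
have [p_lt2|p_ge2] := ltP p 2%R.
  have [k [e1 [k_gt0 e1_gt0 ke1]]] := balanced_sample_size c_gt0 p_gt0 p_lt2.
  exists k, (Num.min e0 e1)%R; split=> //; first by rewrite lt_min e0_gt0.
  move=> e /andP[e_gt0]; rewrite le_min => /andP[ee0 ee1].
  apply/ereal_infP => _ [A Ae ->]; rewrite ifF; last by apply/eqP; lra.
  have [|n hn] := ke1 e; first by rewrite e_gt0.
  have e_small : (e / Num.sqrt (maxn 1 n)%:R <= e0)%R.
    apply: le_trans ee0; rewrite ler_piMr ?(ltW e_gt0)// invf_le1.
      by rewrite -[leLHS]sqrtr1 ler_sqrt// ler1n leq_maxl.
    by rewrite sqrtr_gt0 ltr0n leq_maxl.
  have := sample_size_bound e_gt0 e_small Ae.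
  (* From [n + K <= B <= n + r] the cost of the Monte Carlo samples cancels. *)
  rewrite -EFinM; move: hn; move: (c * _)%R (k * _)%R => B K.
  case: (avg_cost nu A) => [r||].
  - by rewrite -EFinD !lee_fin; lra.
  - by move=> *; rewrite leey.
  - by move=> _; rewrite addeNy leeNy_eq.
(* All admissible costs are infinite, so any constant serves; [e <= 1] and [e <= c / 2] give
   [e ^+ 2 <= c / 2] for the case [p = 2]. *)
exists 1%R, (Num.min 1 (c / 2))%R; split=> //.
  by rewrite lt_min ltr01 divr_gt0.
move=> e /andP[e_gt0]; rewrite le_min => /andP[e_le1 ec].
apply/ereal_infP => _ [A Ae ->]; rewrite (avg_cost_infinite e_gt0 _ Ae) ?leey//.
move: p_ge2; rewrite le_eqVlt => /predU1P[<-|]; [right; split=> //|by left].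
by rewrite expr2 (le_trans _ ec)// ler_piMr// ltW.
Qed.

(** The zero approximation has cost 0 and finite error, whereas [p > 2] would force its cost to be
    infinite. *)
Lemma integration_exponent_le2 :
  \int[nu]_f (codomain_norm (solution (L2_approximation R d) f)) ^+ 2 < +oo ->
  (p <= 2)%R.
Proof.
set I := integral _ _ _ => I_fin; rewrite leNgt; apply/negP => p_gt2.
have I0 : 0 <= I.
  by apply: integral_ge0 => f _; rewrite sqre_ge0// Lnorm_ge0.
have IE : I \is a fin_num by rewrite ge0_fin_numE.
(* Adding 1 keeps the error bound positive even when [I] is 0. *)
have e_gt0 : (0 < Num.sqrt (fine I) + 1)%R by rewrite ltr_wpDl ?sqrtr_ge0.
have := @avg_cost_infinite (no_information R d) _ e_gt0 (or_introl p_gt2).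
rewrite no_information_cost no_information_error -/I => /(_ _)/eqP.
rewrite eq_sym => /(_ _)/negP; apply=> //.
by rewrite -(fineK IE) lee_fin lerDl.
Qed.

End transfer.

Theorem theorem3 (R : realType) (d : nat) (d_ge1 : (1 <= d)%N)
    (nu : probability (CD R d) R) (p : R)
    (Int_lower : big_Omega (avg_complexity (integration R d) nu)
                           (fun eps => (eps `^ (- p))%:E)) :
  ((\int[nu]_f (codomain_norm (solution (L2_approximation R d) f)) ^+ 2 < +oo)%E ->
     p <= 2) /\
  big_Omega (avg_complexity (L2_approximation R d) nu) (approximation_rate p).
Proof.
have [c [e0 [c_gt0 e0_gt0 Int_ge]]] := Int_lower; split.
  exact: integration_exponent_le2 Int_ge.
exact: approximation_lower Int_ge.
Qed.
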